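(* Let $(X,T)$ be a dynamical system. (1) The set of all multi-recurrent points of $(X,T)$ is a $G_\delta$ subset of $X$. (2) If $(X,T)$ is minimal, then the set of all multi-recurrent points is residual in $X$.
   Context: A (topological) dynamical system $(X,T)$ consists of a (nonempty) compact metric space $(X,\rho)$ and a continuous map $T\colon X\to X$. A subsystem is $(K,T)$ with $K\subset X$ nonempty, closed and $T(K)\subset K$; $(X,T)$ is minimal if it has no proper subsystem. $\mathbb{N}$ is the set of positive integers. A point $x\in X$ is multi-recurrent if for every $d\ge 1$ there exists a strictly increasing sequence $\{n_k\}_{k=1}^\infty$ in $\mathbb{N}$ such that $T^{in_k}x\to x$ as $k\to\infty$ for each $i=1,2,\dots,d$. *)

(* Defs.v *)
From mathcomp Require Import all_boot all_order all_algebra.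
From mathcomp Require Import boolp classical_sets functions reals.
From mathcomp Require Import topology normedtype sequences borel_hierarchy.

Set Implicit Arguments.
Unset Strict Implicit.
Unset Printing Implicit Defensive.

Local Open Scope classical_set_scope.

Definition subsystem (X : topologicalType) (T : X -> X) (K : set X) : Prop :=
  [/\ K !=set0, closed K & T @` K `<=` K].

Definition minimal_system (X : topologicalType) (T : X -> X) : Prop :=
  forall K : set X, subsystem T K -> K = [set: X].

(* The sequence is indexed from 0 instead of 1. *)
Definition multi_recurrent (X : topologicalType) (T : X -> X) (x : X) : Prop :=
  forall d : nat, (1 <= d)%N ->
  exists n : nat -> nat,
    [/\ forall k, (0 < n k)%N,
        {homo n : j k / (j < k)%N}
      & forall i : nat, (1 <= i <= d)%N ->
          (fun k => iter (i * n k) T x) @ \oo --> x].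

(* Gdelta_dense G means that G is a countable intersection of dense open sets,
   so a residual set is one whose complement is meager. *)
Definition residual (X : topologicalType) (S : set X) : Prop :=
  exists2 G : set X, Gdelta_dense G & G `<=` S.

(* Main.v *)
Require Import Defs.
From mathcomp Require Import all_boot all_order all_algebra.
From mathcomp Require Import boolp classical_sets functions reals.
From mathcomp Require Import topology normedtype sequences borel_hierarchy.
From mathcomp Require Import interval_inference zify.

Import Order.TTheory GRing.Theory Num.Theory.

Local Open Scope classical_set_scope.

(** A point x is multi-recurrent if and only if, for every m, some open set V
    of small diameter and some n > 0 satisfy T^(i n) x \in V for all i <= m.
    Indeed, given such a V for large m, the multiples of n by a fixed factor
    are return times as well, so return times can be made arbitrarily late and
    a strictly increasing sequence of them can be chosen.  For fixed V, n and m
    the condition on x is open, so multi-recurrence is a countable intersection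
    of open conditions close_returns T m (multi_recurrentE).

    It remains to see that each close_returns T m is dense when the system is
    minimal, that is, that every nonempty open set V contains x, T^n x, ...,
    T^(m n) x for some x and some n > 0 (minimal_multiple_recurrence).  Every
    orbit enters V, and by compactness it does so within a bounded time N.
    Colour each time t by some i < N with T^(t + i) x0 \in V.  By van der
    Waerden's theorem m + 1 times in arithmetic progression a, a + n, ..., a +
    m n receive the same colour j, and x = T^(a + j) x0 is the desired point.

    Van der Waerden's theorem is proved by the classical colour focusing: if
    progressions of length k are unavoidable, then as long as no progression of
    length k + 1 appears one can find progressions of length k in more and more
    distinct colours, all with the same next term, until the colours run out. *)

(** * Van der Waerden's theorem *)

(** The term y that would continue the progression is its focus. Recording the
    focus instead of the first term or the difference lets progressions with
    different differences be compared. *)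
Definition mono_before {C : Type} (c : nat -> C) k x y :=
  exists a d, [/\ (0 < d)%N, (a + k * d)%N = y &
                  forall i, (i < k)%N -> c (a + i * d)%N = x].

Lemma mono_before_shift {C : Type} (c : nat -> C) a k x y :
  mono_before (fun t => c (a + t)%N) k x y -> mono_before c k x (a + y)%N.
Proof.
move=> [b [d [d0 <- cx]]]; exists (a + b)%N, d; split; first by [].
  by rewrite addnA.
by move=> i ik; rewrite -addnA cx.
Qed.

(** If the focus already has the colour of the progression, it can be appended;
    the difference is at most y since 0 < k, which bounds the new focus. *)
Lemma mono_before_extend {C : Type} (c : nat -> C) k y :
  (0 < k)%N -> mono_before c k (c y) y ->
  exists2 y', (y' <= y + y)%N & mono_before c k.+1 (c y) y'.
Proof.
move=> k0 [a [d [d0 ady cx]]]; exists (y + d)%N; first by nia.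
exists a, d; split; [by [] | by rewrite mulSn -ady; lia |].
move=> i; rewrite ltnS leq_eqVlt => /predU1P[->|]; last exact: cx.
by rewrite ady.
Qed.

(** Colouring times by windows turns a progression of times into a progression
    of identically coloured stretches. The windows overlap, unlike the blocks
    of the usual argument, so that no rescaling of the times is needed. *)
Definition window {C : Type} (c : nat -> C) N (t : nat) : {ffun 'I_N -> C} :=
  [ffun j : 'I_N => c (t + j)%N].

Lemma window_eq {C : Type} (c : nat -> C) N s t j :
  window c N s = window c N t -> (j < N)%N -> c (s + j)%N = c (t + j)%N.
Proof.
move=> e jN.
by have := congr1 (fun w : {ffun _ -> _} => w (Ordinal jN)) e; rewrite !ffunE.
Qed.

(** The bound N is on the focus, so that colour focusing can be restarted from
    the conclusion without tracking the differences. *)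
Definition vdW_length k := forall C : finType, exists N, forall c : nat -> C,
  exists x y, (y < N)%N /\ mono_before c k x y.

(** Each further colour is obtained by colouring t with the window of length N
    at t, where N works for r colours. A progression of k equal windows, of
    difference d, carries the r focused progressions of its first window along:
    increasing their differences by d focuses them all on the copy of the old
    focus in the next window. The copies of the old focus in the k windows form
    one more progression with that focus; its colour is new, since otherwise
    the old focus would extend one of the r progressions. *)
Lemma colour_focusing k (C : finType) r : (0 < k)%N -> vdW_length k ->
  exists N, forall c : nat -> C,
    (exists x y, (y < N)%N /\ mono_before c k.+1 x y) \/
    exists y (s : seq C), [/\ (y < N)%N, uniq s, size s = r &
      forall x, x \in s -> mono_before c k x y].
Proof.
move=> k0 Wk; elim: r => [|r [N HN]].
  by exists 1%N => c; right; exists 0%N, [::].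
have [M HM] := Wk {ffun 'I_N -> C}.
exists (M + N + N)%N => c.
have [w [y0 [yM [a [d [d0 y0E cw]]]]]] := HM (window c N).
subst y0.
have wE i j : (i < k)%N -> (j < N)%N -> c (a + i * d + j)%N = c (a + j)%N.
  move=> ik jN; apply: window_eq jN; rewrite cw//.
  by rewrite -(cw 0%N)// mul0n addn0.
have [[x [y [yN mono]]]|[f [s [fN us ss foc]]]] := HN (fun t => c (a + t)%N).
  left; exists x, (a + y)%N; split; first by nia.
  exact: mono_before_shift.
have [fs|fs] := boolP (c (a + f)%N \in s).
  left; have [y yf mono] := mono_before_extend _ _ _ k0 (foc _ fs).
  exists (c (a + f)%N), (a + y)%N; split; first by nia.
  exact: mono_before_shift.
right; exists (a + k * d + f)%N, (c (a + f)%N :: s); split.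
- by lia.
- by rewrite /= fs.
- by rewrite /= ss.
move=> x; rewrite inE => /predU1P[->|xs].
  exists (a + f)%N, d; split; [by [] | by lia |].
  by move=> i ik; rewrite addnAC wE.
have [b [e [e0 bef bx]]] := foc _ xs.
exists (a + b)%N, (d + e)%N; split; [by lia | by lia |].
move=> i ik; rewrite -(bx _ ik).
have -> : (a + b + i * (d + e) = a + i * d + (b + i * e))%N by lia.
by rewrite wE//; nia.
Qed.

Lemma van_der_Waerden k : (0 < k)%N -> vdW_length k.
Proof.
elim: k => [//|[|k] IH] _ C.
  exists 2%N => c; exists (c 0%N), 1%N; split=> //.
  by exists 0%N, 1%N; split=> // -[].
have [N HN] := colour_focusing k.+1 C #|C|.+1 isT (IH isT).
exists N => c; have [//|[y [s [_ us ss _]]]] := HN c.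
by have := max_card (mem s); rewrite (card_uniqP us) ss ltnn.
Qed.

(** * Multiple recurrence in minimal systems *)

Section recurrence.
Context {X : topologicalType} (T : X -> X) (T_continuous : continuous T).

Lemma continuous_iter n : continuous (iter n T).
Proof.
elim: n => [|n IH] x; first exact: cvg_id.
exact: (continuous_comp (IH x) (T_continuous _)).
Qed.

Lemma open_preimage_iter n (V : set X) : open V -> open (iter n T @^-1` V).
Proof. by apply: open_comp => x _; apply: continuous_iter. Qed.

(** The points whose orbits avoid U form a closed invariant set, which is not
    the whole space since U is nonempty. *)
Lemma minimal_hits (U : set X) : minimal_system T -> open U -> U !=set0 ->
  forall x, exists i, U (iter i T x).
Proof.
move=> minT oU [u Uu] x; apply: contrapT => /forallNP notU.
pose K := [set y | forall i, ~ U (iter i T y)].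
suff : K = setT by move=> /seteqP[_ /(_ u I) /(_ 0%N)]; apply.
apply: minT; split; first by exists x.
- have -> : K = \bigcap_i ~` (iter i T @^-1` U).
    by apply/seteqP; split=> [y Ky i _|y Ky i]; apply: Ky.
  apply: closed_bigI => i _; apply: open_closedC.
  exact: open_preimage_iter.
- by move=> _ [y Ky <-] i; rewrite -iterSr; apply: Ky.
Qed.

Lemma minimal_hits_bounded (U : set X) : compact [set: X] ->
  minimal_system T -> open U -> U !=set0 ->
  exists N, forall x, exists i : 'I_N, U (iter i T x).
Proof.
move=> cX minT oU U0.
pose P N x := exists i : 'I_N, U (iter i T x).
have [|N _ HN] := (compact_near_coveringP _).1 cX nat \oo P _.
  move=> x _; have [i Uix] := minimal_hits _ minT oU U0 x.
  exists (iter i T @^-1` U, [set N | (i < N)%N]).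
    split; last by exists i.+1.
    by apply: open_nbhs_nbhs; split=> //; apply: open_preimage_iter.
  by move=> [y N] [/= Uy iN]; exists (Ordinal iN).
by exists N => x; apply: (HN N (leqnn N)).
Qed.

(** The value i = 0 is included, so returns V m n is a subset of V. *)
Definition returns (V : set X) m n : set X :=
  [set x | forall i, (i <= m)%N -> V (iter (i * n) T x)].

Lemma open_returns V m n : open V -> open (returns V m n).
Proof.
rewrite !openE => oV x xV.
suff : \forall y \near x, forall i : 'I_m.+1, V (iter (i * n) T y).
  by apply: filterS => y yV i im; apply: (yV (Ordinal (im : i < m.+1)%N)).
apply: filter_forall => i; apply: (continuous_iter _ _ V).
by apply: oV; apply: xV; rewrite -ltnS.
Qed.

(** Topological multiple recurrence: colour the time t by a bounded waiting time
    until the orbit of T^t x0 visits U, and apply van der Waerden's theorem. *)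
Lemma minimal_multiple_recurrence (U : set X) m : [set: X] !=set0 ->
  compact [set: X] -> minimal_system T -> open U -> U !=set0 ->
  exists2 n, (0 < n)%N & returns U m n !=set0.
Proof.
move=> [x0 _] cX minT oU U0.
have [N HN] := minimal_hits_bounded _ cX minT oU U0.
have [c Hc] := choice (fun t => HN (iter t T x0)).
have [M HM] := van_der_Waerden m.+1 isT 'I_N.
have [j [_ [_ [a [n [n0 _ mono]]]]]] := HM c.
exists n => //; exists (iter (j + a) T x0) => i im.
have -> : iter (i * n) T (iter (j + a) T x0) = iter j T (iter (a + i * n) T x0).
  by rewrite -!iterD; congr (iter _ T x0); lia.
by rewrite -(mono i im); apply: Hc.
Qed.

End recurrence.

(** * Multi-recurrence as a countable intersection of open conditions *)

Definition small {R : realType} {X : pseudoMetricType R} (V : set X) m :=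
  forall y z, V y -> V z -> ball y (m.+1%:R^-1 : R)%R z.

(** Asking that the returns stay in a common small open set, rather than close
    to the starting point, makes openness immediate. The single parameter m
    bounds both the number of returns and their distance. *)
Definition close_returns {R : realType} {X : pseudoMetricType R} (T : X -> X) m
    : set X :=
  \bigcup_(Vn in [set Vn : set X * nat |
                  [/\ open Vn.1, small Vn.1 m & (0 < Vn.2)%N]])
    returns T Vn.1 m Vn.2.

Section pseudometric.
Context {R : realType} {X : pseudoMetricType R} (T : X -> X).

Lemma small_open_nbhs (x : X) m (A : set X) : nbhs x A ->
  exists V : set X, [/\ open V, V x, V `<=` A & small V m].
Proof.
move=> xA; pose e := (m.+1%:R^-1 / 2 : R)%R.
have e0 : (0 < e)%R by rewrite divr_gt0 ?invr_gt0 ?ltr0n.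
exists ((A `&` ball x e)^°); split.
- exact: open_interior.
- by apply: filterI => //; apply: nbhsx_ballx.
- by move=> y /interior_subset[].
- move=> y z /interior_subset[_ /ball_sym xy] /interior_subset[_ xz].
  by rewrite [X in ball y X]splitr; apply: ball_triangle xz.
Qed.

Lemma open_close_returns m : continuous T -> open (close_returns T m).
Proof.
move=> cT; apply: bigcup_open => -[V n] /= [oV _ _].
exact: open_returns.
Qed.

Lemma dense_close_returns m : [set: X] !=set0 -> compact [set: X] ->
  continuous T -> minimal_system T -> dense (close_returns T m).
Proof.
move=> X0 cX cT minT U [u Uu] oU.
have [V [oV Vu VU sV]] := small_open_nbhs u m U (open_nbhs_nbhs (conj oU Uu)).
have [|n n0 [x xV]] := minimal_multiple_recurrence T cT V m X0 cX minT oV.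
  by exists u.
exists x; split; first exact/VU/(xV 0%N).
by exists (V, n).
Qed.

Lemma multi_recurrent_close_returns (x : X) m :
  multi_recurrent T x -> close_returns T m x.
Proof.
move=> /(_ m.+1 isT)[n [n0 _ nx]].
have [V [oV Vx _ sV]] := small_open_nbhs x m setT filterT.
have [K _ HK] : \forall k \near \oo, forall i : 'I_m.+1, V (iter (i * n k) T x).
  apply: filter_forall => i; have [->|i0] := posnP i.
    by apply: nearW => k; rewrite mul0n.
  apply: (nx i); first by rewrite i0 ltnW.
  by apply: open_nbhs_nbhs.
exists (V, n K); first by split=> /=.
by move=> i im /=; apply: (HK K (leqnn K) (Ordinal (im : i < m.+1)%N)).
Qed.

(** A return time n that is good up to the multiple d (K + 1) yields the return
    time (K + 1) n, good up to the multiple d and larger than K. *)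
Lemma close_returns_late (x : X) d K : (forall m, close_returns T m x) ->
  exists n, (K < n)%N /\
    forall i, (i <= d)%N -> ball x (K.+1%:R^-1 : R)%R (iter (i * n) T x).
Proof.
move=> /(_ (d * K.+1 + K)%N)[[V n] /= [_ sV n0] xV].
exists (K.+1 * n)%N; split; first by nia.
move=> i id; apply: (@le_ball _ _ _ ((d * K.+1 + K).+1%:R^-1 : R)%R).
  by rewrite lef_pV2 ?posrE// ler_nat ltnS leq_addl.
apply: sV; first exact: (xV 0%N).
by rewrite mulnA; apply: xV; nia.
Qed.

Lemma close_returns_multi_recurrent (x : X) :
  (forall m, close_returns T m x) -> multi_recurrent T x.
Proof.
move=> xC d d0.
(* g K is later than K and its returns are within 1 / (K + 1) of x, so the
   iterates of g at 0 increase and the returns at these times tend to x. *)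
have [g gP] := choice (fun K => close_returns_late x d K xC).
pose n k := iter k.+1 g 0%N.
have nS k : (n k < n k.+1)%N by exact: (gP _).1.
have kn k : (k <= iter k g 0)%N
  by elim: k => // k /leq_ltn_trans; apply; exact: (gP _).1.
exists n; split.
- by move=> k; apply: leq_trans (kn k.+1).
- exact: homo_ltn ltn_trans nS.
move=> i /andP[_ id]; apply/cvg_ballP => e e0.
near=> k; apply: (@le_ball _ _ _ ((iter k g 0%N).+1%:R^-1 : R)%R).
  apply: (@le_trans _ _ (k.+1%:R^-1)%R).
    by rewrite lef_pV2 ?posrE// ler_nat ltnS.
  apply: ltW; near: k; exact: (near_infty_natSinv_lt (PosNum e0)).
exact: (gP _).2.
Unshelve. all: by end_near. Qed.

Lemma multi_recurrentE :
  [set x | multi_recurrent T x] = \bigcap_m close_returns T m.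
Proof.
apply/seteqP; split=> x.
  by move=> xT m _; apply: multi_recurrent_close_returns.
by move=> xC; apply: close_returns_multi_recurrent => m; apply: xC.
Qed.

End pseudometric.

Theorem lemma3p3 (R : realType) (X : metricType R) (T : X -> X)
    (X_nonempty : [set: X] !=set0) (X_compact : compact [set: X])
    (T_continuous : continuous T) :
  Gdelta [set x | multi_recurrent T x] /\
  (minimal_system T -> residual [set x | multi_recurrent T x]).
Proof.
rewrite multi_recurrentE; split=> [|minT].
  by exists (close_returns T) => // m; apply: open_close_returns.
exists (\bigcap_m close_returns T m) => //.
exists (close_returns T) => // m; split; first exact: open_close_returns.
exact: dense_close_returns.
Qed.
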